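(* Let $r\ge3$ be an odd integer with $r\neq5$. Then every $2$-edge-connected $r$-regular graph admits a $0$-sum $3$-flow.
   Context: For a positive integer $k$ and a real $c$, a $c$-sum $k$-flow on a graph $G=(V,E)$ is a function $\omega:E\to\{\pm1,\ldots,\pm(k-1)\}$ such that $\sum_{e\ni v}\omega(e)=c$ for every vertex $v$. (So a $0$-sum $3$-flow uses values in $\{\pm1,\pm2\}$ and has sum $0$ at every vertex.) *)

(* Defs.v *)
From HB Require Import structures.
From mathcomp Require Import all_boot all_order all_algebra.

Set Implicit Arguments.
Unset Strict Implicit.
Unset Printing Implicit Defensive.

Import GRing.Theory.
Local Open Scope ring_scope.

(* Finite loopless graphs G = (V, E) in which parallel edges are allowed:
   [ends e] is the two-element set of endpoints of e, so "e \ni v" is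
   [v \in ends e].  The simple graphs are the ones with [ends] injective. *)
Record graph := Graph {
  vertex : finType;
  edge : finType;
  ends : edge -> {set vertex};
  card_ends : forall e, #|ends e| = 2%N
}.

Definition incident_edges (G : graph) (v : vertex G) : {set edge G} :=
  [set e | v \in ends e].

Definition regular (G : graph) (r : nat) : Prop :=
  forall v : vertex G, #|incident_edges v| = r.

(* Adjacency in G - F, the spanning subgraph obtained by deleting F. *)
Definition adjacent_minus (G : graph) (F : {set edge G}) : rel (vertex G) :=
  fun x y => [exists e, (e \notin F) && (ends e == [set x; y])].

Definition connected_minus (G : graph) (F : {set edge G}) : Prop :=
  forall x y : vertex G, connect (adjacent_minus F) x y.

Definition edge_connected (k : nat) (G : graph) : Prop :=
  (1 < #|vertex G|)%N /\
  forall F : {set edge G}, (#|F| < k)%N -> connected_minus F.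

(* The prescribed sum c may be taken in int: as w is integer-valued, no
   nonintegral real c admits a c-sum k-flow. *)
Definition sum_flow (c : int) (k : nat) (G : graph) (w : edge G -> int) : Prop :=
  (forall e, w e != 0 /\ (`|w e| < k)%N) /\
  (forall v, \sum_(e in incident_edges v) w e = c).

Definition admits_sum_flow (c : int) (k : nat) (G : graph) : Prop :=
  exists w : edge G -> int, sum_flow c k w.

(* Main.v *)
Require Import Defs.
From HB Require Import structures.
From mathcomp Require Import all_boot all_order all_algebra.
From mathcomp Require Import all_fingroup zify.

Set Implicit Arguments.
Unset Strict Implicit.
Unset Printing Implicit Defensive.

(** For odd r >= 3 other than 5 there is an even k with r/2 <= k <= 2r/3.
    A 2-edge-connected r-regular graph with r odd has a k-factor B, and the
    even-regular graph B has a (2r-3k)-factor B'.  Giving weight 2 to the edges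
    outside B, -2 to those of B' and -1 to the rest of B makes every vertex sum
    2(r-k) - 2(2r-3k) - (k-(2r-3k)) = 0.

    Both factors come from one statement: a d-regular multigraph has a k-factor
    (k even) if every odd edge cut of size c satisfies d <= c(d-k).  In G odd
    cuts have size at least 3, and an even-regular graph has no odd cut.  The
    constant weight k/d on the edges induces a fractional perfect matching of
    Tutte's gadget graph satisfying Edmonds' odd cut inequalities, and such a
    fractional matching forces a perfect matching, by the saturation argument
    of Lovasz's proof of Tutte's theorem. *)

(** * Lovasz's exchange of two matchings *)

Definition perfect_matching (T : finType) (e : rel T) (m : T -> T) : Prop :=
  involutive m /\ forall x, e x (m x).

Lemma even_card_involution (T : finType) (m : T -> T) (S : {set T}) :
    involutive m -> (forall x, m x != x) -> {in S, forall x, m x \in S} ->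
  ~~ odd #|S|.
Proof.
move=> mK mN; have [n] := ubnP #|S|; elim: n S => // n IH S ltSn mS.
case: (set_0Vmem S) => [->|[x xS]]; first by rewrite cards0.
have mxS : m x \in S :\ x by rewrite !inE mN mS.
rewrite (cardsD1 x) xS (cardsD1 (m x)) mxS /= negbK.
apply: IH => [|y].
  by move: ltSn; rewrite (cardsD1 x) xS (cardsD1 (m x)) mxS; lia.
rewrite !inE => /and3P[yNmx yNx yS].
by rewrite (inj_eq (inv_inj mK)) yNx mS // andbT -[x in _ != x]mK (inj_eq (inv_inj mK)) yNmx.
Qed.

Lemma even_type_involution (T : finType) :
  ~~ odd #|T| -> exists m : T -> T, involutive m /\ forall x, m x != x.
Proof.
(* Ranks 2i and 2i+1 are paired; an even cardinal keeps every partner in range. *)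
move=> evT; pose s i := if odd i then i.-1 else i.+1.
have s_lt (i : 'I_#|T|) : s i < #|T|.
  by have := ltn_ord i; move: evT; rewrite /s; case: (boolP (odd i)); lia.
have sK i : s (s i) = i.
  by rewrite /s; case: (boolP (odd i)) => oi; case: ifP; lia.
have sN i : s i != i by rewrite /s; case: (boolP (odd i)); lia.
exists (fun x => enum_val (Ordinal (s_lt (enum_rank x)))); split=> x.
  by apply: enum_rank_inj; apply: val_inj; rewrite /= !enum_valK /= sK.
apply: contra (sN (enum_rank x)) => /eqP/(congr1 enum_rank).
by rewrite enum_valK => /(congr1 val) /= ->.
Qed.

(* The map is a reflection in the dihedral group generated by [m1] and [m2],
   hence conjugate to one of them. *)
Lemma dihedral_reflection_fixfree (T : Type) (m1 m2 : T -> T) :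
    involutive m1 -> involutive m2 ->
    (forall x, m1 x <> x) -> (forall x, m2 x <> x) ->
  forall i x, m1 (iter i (m2 \o m1) x) <> x.
Proof.
move=> m1K m2K m1N m2N i; have [n] := ubnP i.
elim: n i => // n IH [|[|i]] lti x; first exact: m1N.
  by move=> /= /(congr1 m1); rewrite m1K; exact: m2N.
rewrite iterS iterSr /= => /(congr1 m1); rewrite m1K => /(congr1 m2); rewrite m2K.
by apply: IH; lia.
Qed.

Section LovaszExchange.
Variables (T : finType) (e : rel T) (m1 m2 : T -> T) (a b c d : T).
Hypotheses (eS : symmetric e).
Hypotheses (m1K : involutive m1) (m1N : forall x, m1 x <> x).
Hypotheses (m2K : involutive m2) (m2N : forall x, m2 x <> x).
Hypotheses (m1a : m1 a = c) (m2b : m2 b = d) (eab : e a b) (ebc : e b c).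
Hypothesis m1e : forall x, x != a -> x != c -> e x (m1 x).
Hypothesis m2e : forall x, x != b -> x != d -> e x (m2 x).

Let g := m2 \o m1.

Let gI : injective g.
Proof. exact: inj_comp (inv_inj m2K) (inv_inj m1K). Qed.

Let m1c : m1 c = a. Proof. by rewrite -m1a m1K. Qed.
Let m2d : m2 d = b. Proof. by rewrite -m2b m2K. Qed.

(* Following the alternating path from [b], first along [m1], stop at the first
   of [a] and [c]; its [m1]-partner [c'] is the other one.  The edge [b c'] and
   the [m2]-edges of the path match the same vertices as [m1] does. *)
Lemma exchange_hit j : iter j g b \in [:: a; c] ->
  (forall i, iter i g b \in [:: a; c] -> j <= i) -> exists m, perfect_matching e m.
Proof.
move=> hitj minj; pose c' := m1 (iter j g b).
have c'ac : c' \in [:: a; c].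
  by rewrite /c'; move: hitj; rewrite !inE => /orP[]/eqP->; rewrite ?m1a ?m1c eqxx ?orbT.
have ebc' : e b c'.
  by move: c'ac; rewrite !inE => /orP[]/eqP->; rewrite // eS.
have refl i y : m1 (iter i g y) <> y by apply: dihedral_reflection_fixfree.
have bNc' : b != c' by apply/eqP => bc'; apply: (refl j b).
pose Z := [set x | [exists i : 'I_j.+1, (x == iter i g b) || (x == m1 (iter i g b))]].
have ZP x : reflect (exists2 i, i <= j & x = iter i g b \/ x = m1 (iter i g b)) (x \in Z).
  rewrite inE; apply: (iffP existsP) => [[i /orP[]/eqP xE]|[i leij xE]].
  - by exists i; [rewrite -ltnS | left].
  - by exists i; [rewrite -ltnS | right].
  by exists (inord i); rewrite inordK //; case: xE => ->; rewrite eqxx ?orbT.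
have m1Z x : x \in Z -> m1 x \in Z.
  move=> /ZP[i leij xE]; apply/ZP; exists i => //.
  by case: xE => ->; rewrite ?m1K; [right|left].
(* Without its two ends the path is paired up by [m2]: minimality of [j] and [refl] keep [m2] from
   reaching [b] or [c']. *)
pose Y := Z :\: [set b; c'].
have bY : b \notin Y by rewrite !inE eqxx.
have c'Y : c' \notin Y by rewrite !inE eqxx orbT.
have m2Y x : x \in Y -> m2 x \in Y.
  rewrite !in_setD !in_set2 !negb_or -!andbA => /and3P[xNb xNc' /ZP[i leij xE]].
  apply/and3P.
  case: xE => xE; move: xNb xNc'; rewrite xE.
    case: i leij {xE} => [|i] leij; first by rewrite eqxx.
    rewrite iterS /= m2K => _ _; split.
    - by apply/eqP; apply: refl.
    - rewrite (inj_eq (inv_inj m1K)); apply/eqP=> E.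
      by have := minj i; rewrite E hitj => /(_ isT); lia.
    by apply/ZP; exists i; [lia | right].
  move=> _; rewrite (inj_eq (inv_inj m1K)) => iNj.
  have ltij : i < j by rewrite ltn_neqAle leij andbT; apply: contra iNj => /eqP->.
  have mE : m2 (m1 (iter i g b)) = iter i.+1 g b by [].
  have jE : iter j g b = iter (j - i.+1) g (iter i.+1 g b).
    by rewrite -iterD; congr iter; lia.
  rewrite mE; split.
  - apply/eqP=> E; rewrite E in jE.
    by have := minj (j - i.+1); rewrite -jE hitj => /(_ isT); lia.
  - by apply/eqP=> E; apply: (refl (j - i.+1) (iter i.+1 g b)); rewrite -jE.
  by apply/ZP; exists i.+1; [|left].
have m1bc' x : x \notin Y -> x != b -> x != c' -> x \notin Z.
  by rewrite in_setD in_set2 => /[swap] /negbTE-> /[swap] /negbTE->.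
have ZbI : b \in Z by apply/ZP; exists 0; [|left].
have Zc' : c' \in Z by apply/ZP; exists j; [|right].
pose m x := if x == b then c' else if x == c' then b else if x \in Y then m2 x else m1 x.
exists m; split=> x; rewrite /m.
  case: (eqVneq x b) => [->|xNb]; first by rewrite eqxx eq_sym (negbTE bNc').
  case: (eqVneq x c') => [->|xNc']; first by rewrite eqxx.
  case: (boolP (x \in Y)) => xY.
    have mY := m2Y x xY; rewrite mY.
    case: eqP => [E|_]; first by rewrite E (negbTE bY) in mY.
    case: eqP => [E|_]; first by rewrite E (negbTE c'Y) in mY.
    exact: m2K.
  have xZ := m1bc' x xY xNb xNc'.
  have mZ : m1 x \notin Z by apply: contra xZ => /m1Z; rewrite m1K.
  case: eqP => [E|_]; first by rewrite E ZbI in mZ.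
  case: eqP => [E|_]; first by rewrite E Zc' in mZ.
  by rewrite in_setD (negbTE mZ) andbF m1K.
case: (eqVneq x b) => [->//|xNb].
case: (eqVneq x c') => [->|xNc']; first by rewrite eS.
case: (boolP (x \in Y)) => xY.
  by apply: m2e => //; apply: contraNneq bY => xd; rewrite -m2d -xd m2Y.
have xZ := m1bc' x xY xNb xNc'.
have acZ y : y \in [:: a; c] -> y \in Z.
  move=> yac; have : (y == iter j g b) || (y == c').
    have aNc : a != c by rewrite -m1a eq_sym; apply/eqP.
    by move: yac hitj; rewrite /c' !inE => /orP[]/eqP-> /orP[]/eqP->;
      rewrite ?m1a ?m1c eqxx ?orbT.
  by case/orP=> /eqP-> //; apply/ZP; exists j; [|left].
by apply: m1e; apply: contraNneq xZ => ->; apply: acZ; rewrite !inE eqxx ?orbT.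
Qed.

(** [m1] and [m2] are perfect matchings up to the exceptional pairs ac and bd. If the orbit of [b]
    misses [a] and [c], the alternating component of [b] contains bd but not ac, so [m1] serves on
    it and [m2] elsewhere. *)
Lemma lovasz_exchange : exists m, perfect_matching e m.
Proof.
have [/orP hit|/norP[nha nhc]] := boolP (fconnect g b a || fconnect g b c).
  have hitE : exists i, iter i g b \in [:: a; c].
    by case: hit => h; [exists (findex g b a) | exists (findex g b c)];
      rewrite iter_findex // !inE eqxx ?orbT.
  by case: (ex_minnP hitE) => j; apply: exchange_hit.
pose Z x := fconnect g b x || fconnect g b (m1 x).
have m1Z x : Z (m1 x) = Z x by rewrite /Z m1K orbC.
have m2Zi x : Z x -> Z (m2 x).
  case/orP=> bx; apply/orP; last first.
    by left; apply: connect_trans bx _; rewrite -[in m2 x](m1K x); exact: fconnect1.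
  right; apply: connect_trans bx _; rewrite fconnect_sym //.
  by rewrite -[X in fconnect _ _ X](m2K x) -[in X in fconnect _ _ X](m1K (m2 x)); exact: fconnect1.
have m2Z x : Z (m2 x) = Z x.
  by apply/idP/idP => [/m2Zi|]; [rewrite m2K | exact: m2Zi].
have Zb : Z b by rewrite /Z connect0.
exists (fun x => if Z x then m1 x else m2 x); split=> x /=; case: (boolP (Z x)) => Zx.
- by rewrite m1Z Zx m1K.
- by rewrite m2Z (negbTE Zx) m2K.
- by apply: m1e; apply: contraTneq Zx => ->; rewrite /Z ?m1a ?m1c negb_or nha nhc.
- apply: m2e; first by apply: contraNneq Zx => ->.
  by apply: contraNneq Zx => ->; rewrite -m2b m2Z.
Qed.

End LovaszExchange.

(** * Perfect matchings from odd cut inequalities *)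

(** Conjugation by the transposition of [m p] and [q] does the re-pairing. *)
Lemma swap_pairs (T : finType) (m : T -> T) (p q : T) :
    involutive m -> (forall x, m x != x) -> q != p -> q != m p ->
  exists m', [/\ involutive m', m' p = q, m' (m p) = m q &
    forall x, x != p -> x != q -> x != m p -> x != m q -> m' x = m x].
Proof.
move=> mK mN qNp qNmp; pose t := tperm (m p) q.
have mI := inj_eq (inv_inj mK).
have tp : t p = p by rewrite tpermD // eq_sym // eq_sym.
have tmq : t (m q) = m q by rewrite tpermD // ?mI 1?eq_sym.
exists (fun x => t (m (t x))); split.
- by move=> x; rewrite tpermK mK tpermK.
- by rewrite tp tpermL.
- by rewrite tpermL tmq.
move=> x xNp xNq xNmp xNmq; have tx : t x = x by rewrite tpermD // eq_sym.
by rewrite tx tpermD // eq_sym ?mI // -[q]mK mI.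
Qed.

Section Edmonds.
Variables (T : finType) (x : T -> T -> nat) (d : nat).
Hypotheses (d_gt0 : 0 < d) (x_col : forall v, \sum_u x u v <= d).
Hypothesis x_cut : forall C : {set T}, odd #|C| ->
  d <= \sum_(u in C) \sum_(v | v \notin C) x u v.

(* By [e_tr] adjacency is transitive through every vertex outside the set [U] of
   universal vertices, so removing [U] leaves disjoint cliques.  A matching
   missing only [a] and [c] can be rematched to a perfect one unless every
   clique contains at most one vertex of [D]; then these cliques are odd and
   there are more than [#|U|] of them, against the cut inequalities. *)
Section Saturated.
Variables (e : rel T) (a c : T) (m : T -> T).
Hypotheses (eS : symmetric e) (eI : irreflexive e).
Hypothesis xe : forall u v, x u v != 0 -> e u v.
Hypotheses (aNc : a != c) (eNac : ~~ e a c).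
Hypothesis e_tr : forall b z, b != z -> ~~ e b z ->
  forall u v, e u b -> e b v -> u != v -> e u v.
Hypotheses (mK : involutive m) (ma : m a = c).
Hypothesis me : forall y, y != a -> y != c -> e y (m y).

Let U := [set u | [forall v, (v != u) ==> e u v]].

Let UP u v : u \in U -> v != u -> e u v.
Proof. by rewrite inE => /forallP/(_ v)/implyP. Qed.

Let aU : a \notin U.
Proof. by apply: contra eNac => /UP; apply; rewrite eq_sym. Qed.

Let cU : c \notin U.
Proof. by apply: contra eNac => /UP; rewrite eS; apply. Qed.

Let UNac u : u \in U -> (u != a) * (u != c).
Proof. by move=> uU; split; [apply: contraNneq aU | apply: contraNneq cU] => <-. Qed.

Let fixfree m' : m' a = c -> m' c = a ->
  (forall y, y != a -> y != c -> e y (m' y)) -> forall y, m' y != y.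
Proof.
move=> m'a m'c m'e y; case: (eqVneq y a) => [->|yNa]; first by rewrite m'a eq_sym.
case: (eqVneq y c) => [->|yNc]; first by rewrite m'c.
by apply/eqP => E; have := m'e y yNa yNc; rewrite E eI.
Qed.

Let eNS u v : u \in U -> v \notin U -> e u v.
Proof. by move=> uU vU; apply: UP => //; apply: contraNneq vU => ->. Qed.

(** The universal vertices [u] and [m' u] give up each other and absorb [a] and [c]. *)
Lemma rematch_universal_pair m' u : involutive m' -> m' a = c ->
    (forall y, y != a -> y != c -> e y (m' y)) -> u \in U -> m' u \in U ->
  exists m'', perfect_matching e m''.
Proof.
move=> m'K m'a m'e uU mU; have m'c : m' c = a by rewrite -m'a m'K.
have [uNa uNc] := UNac uU.
have [m'' [K Ea Ec E]] : exists m'', [/\ involutive m'', m'' a = u, m'' (m' a) = m' u &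
    forall y, y != a -> y != u -> y != m' a -> y != m' u -> m'' y = m' y].
  by apply: swap_pairs => //; [exact: fixfree | rewrite m'a].
rewrite m'a in Ec E; exists m''; split=> // y.
case: (eqVneq y a) => [->|yNa]; first by rewrite Ea eS eNS.
case: (eqVneq y c) => [->|yNc]; first by rewrite Ec eS eNS.
case: (eqVneq y u) => [->|yNu]; first by rewrite -Ea K Ea eNS.
case: (eqVneq y (m' u)) => [->|yNm]; first by rewrite -Ec K Ec eNS.
by rewrite E // m'e.
Qed.

(** The hole [w1] takes [w2]; the other hole [m w1] takes the universal vertex [m w2]. *)
Lemma rematch_hole w1 w2 : w1 \in [set a; c] -> m w2 \in U -> e w1 w2 ->
  exists m'', perfect_matching e m''.
Proof.
move=> w1ac m2U e12; have mc : m c = a by rewrite -ma mK.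
have [m2Na m2Nc] := UNac m2U.
have w2Na : w2 != a by apply: contraNneq m2Nc => ->; rewrite ma.
have w2Nc : w2 != c by apply: contraNneq m2Na => ->; rewrite mc.
have m1ac : m w1 \in [set a; c].
  by move: w1ac; rewrite !inE => /orP[]/eqP->; rewrite ?ma ?mc eqxx ?orbT.
have acE y : y != w1 -> y != m w1 -> y != a /\ y != c.
  by move: w1ac; rewrite !inE => /orP[]/eqP->; rewrite ?ma ?mc; split.
have [m'' [K E1 E2 E]] : exists m'', [/\ involutive m'', m'' w1 = w2, m'' (m w1) = m w2 &
    forall y, y != w1 -> y != w2 -> y != m w1 -> y != m w2 -> m'' y = m y].
  apply: swap_pairs => //; first exact: fixfree.
    by apply: contraTneq e12 => ->; rewrite eI.
  by move: m1ac; rewrite !inE => /orP[]/eqP->.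
have m1U : m w1 \notin U by move: m1ac; rewrite in_set2 => /orP[]/eqP->.
exists m''; split=> // y.
case: (eqVneq y w1) => [->|yN1]; first by rewrite E1.
case: (eqVneq y w2) => [->|yN2]; first by rewrite -E1 K E1 eS.
case: (eqVneq y (m w1)) => [->|yNm1]; first by rewrite E2 eS eNS.
case: (eqVneq y (m w2)) => [->|yNm2]; first by rewrite -E2 K E2 eNS.
by have [? ?] := acE y yN1 yNm1; rewrite E // me.
Qed.

(** The non-universal vertices that [m] does not match inside their own clique. *)
Let D := [set w | (w \notin U) && ((m w \in U) || (w \in [set a; c]))].

Let DE w : (w \in D) = (w \notin U) && ((m w \in U) || (w \in [set a; c])).
Proof. by rewrite in_set. Qed.

Lemma rematch_clique_pair w1 w2 : w1 \in D -> w2 \in D -> e w1 w2 ->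
  exists m'', perfect_matching e m''.
Proof.
rewrite !DE => /andP[w1U /orP[m1U|w1ac]] /andP[w2U /orP[m2U|w2ac]] e12.
- have mc : m c = a by rewrite -ma mK.
  have NE w : w \notin U -> m w \in U -> [/\ a != w, a != m w, c != w & c != m w].
    move=> wU mwU; have [mwa mwc] := UNac mwU.
    rewrite [a == m _]eq_sym [c == m _]eq_sym mwa mwc.
    by split=> //; [apply: contraNneq mwc | apply: contraNneq mwa] => <-; rewrite ?ma ?mc.
  have [a1 am1 c1 cm1] := NE w1 w1U m1U; have [a2 am2 c2 cm2] := NE w2 w2U m2U.
  have w2N1 : w2 != w1 by apply: contraTneq e12 => ->; rewrite eI.
  have [m' [K E1 E2 E]] : exists m', [/\ involutive m', m' w1 = w2, m' (m w1) = m w2 &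
      forall y, y != w1 -> y != w2 -> y != m w1 -> y != m w2 -> m' y = m y].
    apply: swap_pairs => //; first exact: fixfree.
    by apply: contraNneq w2U => ->.
  (* After the swap [m w1] and [m w2] are universal partners. *)
  apply: (@rematch_universal_pair m' (m w1)) => //; first by rewrite E.
    move=> y yNa yNc.
    case: (eqVneq y w1) => [->|yN1]; first by rewrite E1.
    case: (eqVneq y w2) => [->|yN2]; first by rewrite -E1 K E1 eS.
    have m21 : m w2 != m w1 by rewrite (inj_eq (inv_inj mK)).
    case: (eqVneq y (m w1)) => [->|yNm1]; first by rewrite E2 UP.
    case: (eqVneq y (m w2)) => [->|yNm2]; first by rewrite -E2 K E2 eS UP.
    by rewrite E // me.
  by rewrite E2.
- by apply: (@rematch_hole w2 w1) => //; rewrite eS.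
- exact: (@rematch_hole w1 w2).
- by move: e12 w1ac w2ac; rewrite !in_set2 => /[swap] /orP[]/eqP-> /[swap] /orP[]/eqP->;
    rewrite ?eI // ?(negbTE eNac) // eS (negbTE eNac).
Qed.

Let K w := [set y | (y \notin U) && ((y == w) || e w y)].

Let KE w y : (y \in K w) = (y \notin U) && ((y == w) || e w y).
Proof. by rewrite in_set. Qed.

(** A non-universal [y] has a non-neighbour, so [e_tr] applies at [y]. *)
Let KP w y z : w \notin U -> y \in K w -> z \notin U -> e y z -> z \in K w.
Proof.
move=> wU; rewrite !KE => /andP[yU yw] zU eyz.
rewrite zU /=; case: (eqVneq z w) => //= zNw.
case/orP: yw => [/eqP<-//|ewy].
have [v vNy Nev] : exists2 v, y != v & ~~ e y v.
  move: yU; rewrite inE negb_forall => /existsP[v]; rewrite negb_imply => /andP[vy ev].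
  by exists v => //; rewrite eq_sym.
by apply: (e_tr vNy Nev) => //; rewrite eq_sym.
Qed.

(** The other members of the clique are outside [D], hence paired by [m] within the clique, and none
    of them with [w]. *)
Let Kodd w : {in D &, forall w1 w2, w1 != w2 -> ~~ e w1 w2} -> w \in D -> odd #|K w|.
Proof.
move=> Dindep wD; have := wD; rewrite DE => /andP[wU wor].
have wK : w \in K w by rewrite KE wU eqxx.
have mc : m c = a by rewrite -ma mK.
rewrite (cardsD1 w) wK /=; apply: (@even_card_involution _ m) => // [|y]; first exact: fixfree.
rewrite !in_setD1 => /andP[yNw yK].
have := yK; rewrite KE (negbTE yNw) /= => /andP[yU ewy].
have yD : y \notin D.
  by apply/negP=> yD; have := Dindep w y wD yD; rewrite eq_sym yNw ewy => /(_ isT).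
move: yD; rewrite DE yU /= negb_or in_set2 negb_or => /and3P[mU yNa yNc].
rewrite (KP wU yK) ?me // andbT.
apply: contraNneq yU => mw; have mwy : m w = y by rewrite -mw mK.
case/orP: wor; first by rewrite mwy.
rewrite in_set2 => /orP[]/eqP wE; move: mwy; rewrite wE ?ma ?mc => E.
  by rewrite E eqxx in yNc.
by rewrite E eqxx in yNa.
Qed.

Lemma matching_of_saturated : exists m', perfect_matching e m'.
Proof.
have [/existsP[u /andP[uU mU]]|noU] := boolP [exists u, (u \in U) && (m u \in U)].
  exact: rematch_universal_pair mU.
have [/existsP[w1 /existsP[w2 /and3P[w1D w2D e12]]]|noD] :=
    boolP [exists w1, exists w2, [&& w1 \in D, w2 \in D & e w1 w2]].
  exact: rematch_clique_pair e12.
exfalso.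
have Dindep : {in D &, forall w1 w2, w1 != w2 -> ~~ e w1 w2}.
  move=> w1 w2 w1D w2D _; apply: contra noD => e12.
  by apply/existsP; exists w1; apply/existsP; exists w2; rewrite w1D w2D.
have mc : m c = a by rewrite -ma mK.
(* [D] contains the partners of [U] and the two holes. *)
have cardD : #|U| + 2 <= #|D|.
  have -> : #|U| + 2 = #|(m @: U) :|: [set a; c]|.
    rewrite cardsU cards2 aNc card_imset; last exact: inv_inj.
    rewrite (_ : _ :&: _ = set0) ?cards0 ?subn0 //.
    apply/eqP; rewrite setI_eq0; apply/pred0P => y /=; apply/negP => /andP[/imsetP[u uU ->]].
    have [uNa uNc] := UNac uU; rewrite !inE => /orP[]/eqP E.
      by move: uNc; rewrite -[u]mK E ma eqxx.
    by move: uNa; rewrite -[u]mK E mc eqxx.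
  apply: subset_leq_card; apply/subsetP => y; rewrite in_setU => /orP[/imsetP[u uU ->]|yac].
    rewrite DE mK uU andbT; apply: contra noU => mU.
    by apply/existsP; exists u; rewrite uU.
  by rewrite DE yac orbT andbT; move: yac; rewrite in_set2 => /orP[]/eqP->.
have lower : d * #|D| <= \sum_(w in D) \sum_(y in K w) \sum_(z | z \notin K w) x y z.
  rewrite mulnC -sum_nat_const; apply: leq_sum => w wD.
  exact: x_cut (Kodd Dindep wD).
(* Positive weight leaving a clique ends in [U], the cliques are disjoint, and each vertex of [U]
   receives at most [d]. *)
have upper : \sum_(w in D) \sum_(y in K w) \sum_(z | z \notin K w) x y z <= d * #|U|.
  have xS1 : \sum_(w in D) \sum_(y in K w) \sum_(z | z \notin K w) x y z <=
             \sum_(w in D) \sum_(y in K w) \sum_(z in U) x y z.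
    apply: leq_sum => w; rewrite DE => /andP[wU _].
    apply: leq_sum => y yK; rewrite [leqRHS](bigID (fun z => z \in K w)) /=.
    apply: leq_trans (leq_addl _ _); rewrite big_mkcond [leqRHS]big_mkcond /=.
    apply: leq_sum => z _; case: ifP => // zK; case: (boolP (z \in U)) => zU //=.
    case: (eqVneq (x y z) 0) => [->//|/xe eyz].
    by rewrite (KP wU yK zU eyz) in zK.
  apply: leq_trans xS1 _; rewrite (exchange_big_dep xpredT) //=.
  apply: (@leq_trans (\sum_y \sum_(z in U) x y z)).
    apply: leq_sum => y _; rewrite sum_nat_cond_const -[leqRHS]mul1n leq_mul2r.
    apply/orP; right; apply/card_le1_eqP => w1 w2 /setIdP[w1D y1] /setIdP[w2D y2].
    have [w1U w2U] : w1 \notin U /\ w2 \notin U.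
      by split; [move: w1D | move: w2D]; rewrite DE => /andP[].
    have w1K2 : w1 \in K w2.
      move: (y1); rewrite KE => /andP[_ /orP[/eqP<-//|e1]].
      by apply: (KP w2U y2 w1U); rewrite eS.
    move: w1K2; rewrite KE => /andP[_ /orP[/eqP->//|e21]].
    by apply: contraTeq e21; apply: Dindep.
  rewrite exchange_big /= mulnC -sum_nat_const; apply: leq_sum => z _; exact: x_col.
have := leq_trans lower upper; rewrite leq_pmul2l //; lia.
Qed.
End Saturated.
(* The hypothesis on the weights is monotone in [e], so adding an edge preserves
   it; this replaces the count of odd components in Tutte's condition. *)
Lemma matching_of_odd_cuts (e : rel T) :
    symmetric e -> irreflexive e -> (forall u v, x u v != 0 -> e u v) ->
  exists m, perfect_matching e m.
Proof.
pose nonedges (e : rel T) := [set p : T * T | (p.1 != p.2) && ~~ e p.1 p.2].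
have [n] := ubnP #|nonedges e|; elim: n e => // n IH e lt_n eS eI xe.
(* By induction [e] plus the edge ac has a perfect matching; the two cases are whether it avoids or
   uses ac. *)
have IH2 a c : a != c -> ~~ e a c -> (exists m, perfect_matching e m) \/
    exists m, [/\ involutive m, m a = c, forall y, m y <> y &
                  forall y, y != a -> y != c -> e y (m y)].
  move=> aNc eNac.
  pose e' u v := [|| e u v, (u == a) && (v == c) | (u == c) && (v == a)].
  have e'I : irreflexive e'.
    move=> u; rewrite /e' eI /=; apply/negP => /orP[]/andP[/eqP-> /eqP E];
    by move: aNc; rewrite E eqxx.
  have [|u v|//|u v /xe euv|m [mK me']] := IH e'.
  - rewrite -ltnS; apply: leq_ltn_trans lt_n; apply: proper_card; apply/properP; split.
      apply/subsetP => p; rewrite !inE => /andP[-> /=]; apply: contra => epp.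
      by rewrite /e' epp.
    by exists (a, c); rewrite !inE /= aNc //= /e' !eqxx orbT.
  - by rewrite /e' eS; congr (_ || _); rewrite orbC ![(u == _) && _]andbC.
  - by rewrite /e' euv.
  have [mac|mac] := eqVneq (m a) c.
    right; exists m; split=> // y; first by move=> E; have := me' y; rewrite E e'I.
    by move=> /negbTE yNa /negbTE yNc; have := me' y; rewrite /e' yNa yNc /= !orbF.
  left; exists m; split=> // y; have /or3P[//|/andP[/eqP-> /eqP E]|/andP[/eqP yE /eqP E]] := me' y.
    by rewrite E eqxx in mac.
  by rewrite -E mK yE eqxx in mac.
have [/existsP[a /existsP[c /andP[aNc eNac]]]|complete] :=
    boolP [exists a, exists c, (a != c) && ~~ e a c]; last first.
  (* The whole vertex set has an empty cut, so it cannot be odd. *)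
  have evT : ~~ odd #|T|.
    apply/negP=> oddT; have := x_cut (C := [set: T]); rewrite cardsT => /(_ oddT).
    rewrite big1 ?leqn0 => [/eqP d0|u _]; first by move: d_gt0; rewrite d0.
    by rewrite big_pred0 // => v; rewrite in_setT.
  have [m [mK mN]] := even_type_involution evT; exists m; split=> // y.
  apply: contraNT complete => eNy; apply/existsP; exists y; apply/existsP; exists (m y).
  by rewrite eq_sym mN.
have [bad|good] := boolP [exists b, exists z, exists u, exists v,
    [&& b != z, ~~ e b z, e u b, e b v, u != v & ~~ e u v]].
  case/existsP: bad => b /existsP[z /existsP[u /existsP[v /and5P[bz ebz eub ebv /andP[uv euv]]]]].
  have [//|[m1 [m1K m1u m1N m1e]]] := IH2 u v uv euv.
  have [//|[m2 [m2K m2b m2N m2e]]] := IH2 b z bz ebz.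
  exact: (lovasz_exchange eS m1K m1N m2K m2N m1u m2b eub ebv m1e m2e).
have [//|[m [mK ma mN me]]] := IH2 a c aNc eNac.
apply: (matching_of_saturated eS eI xe aNc eNac _ mK ma me) => b z bz ebz u v eub ebv uv.
apply: contraNT good => euv; apply/existsP; exists b; apply/existsP; exists z.
by apply/existsP; exists u; apply/existsP; exists v; rewrite bz ebz eub ebv uv.
Qed.

End Edmonds.

(** * Regular factors *)

Lemma sum_eq_indicator (I : finType) (j : I) : \sum_i (i == j) = 1.
Proof. by rewrite (bigD1 j) //= eqxx big1 // => i /negbTE->. Qed.

Lemma big_half_edges (E : finType) (F : E * bool -> nat) :
  \sum_h F h = \sum_e (F (e, true) + F (e, false)).
Proof.
rewrite (eq_bigr (fun h => F (h.1, h.2))) => [|[e b] _ //].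
rewrite -(pair_bigA _ (fun e b => F (e, b))) /=.
by apply: eq_bigr => e _; rewrite big_bool.
Qed.

Lemma odd_sum_half_edges (E : finType) (f : E * bool -> bool) :
  odd (\sum_h f h) = odd (\sum_e (f (e, true) (+) f (e, false))).
Proof.
rewrite big_half_edges !(big_morph odd oddD (erefl _)).
by apply: eq_bigr => e _; case: (f _); case: (f _).
Qed.

Section Factor.
Variables (V E : finType) (ep : E * bool -> V) (d k : nat).

(** Pairs in [E * bool] are half-edges attached by [ep]; parallel edges and loops are allowed, and a
    loop crosses no cut. *)
Definition crossing (X : {set V}) (e : E) : bool :=
  (ep (e, true) \in X) (+) (ep (e, false) \in X).

Hypotheses (deg : forall v, \sum_h (ep h == v) = d) (d_gt0 : 0 < d).
Hypotheses (k_even : ~~ odd k) (le_kd : k <= d).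
Hypothesis odd_cut : forall X : {set V}, odd (\sum_e crossing X e) ->
  d <= (\sum_e crossing X e) * (d - k).

Lemma sum_end_in (X : {set V}) : \sum_h (ep h \in X) = #|X| * d.
Proof.
rewrite -sum_nat_const [RHS](eq_bigr (fun v => \sum_h (ep h == v))) => [|v _ //].
rewrite exchange_big; apply: eq_bigr => h _ /=; case: (boolP (ep h \in X)) => hX.
  by rewrite (bigD1 (ep h)) //= eqxx big1 // => v /andP[_]; rewrite eq_sym => /negbTE->.
by rewrite big1 // => v vX; case: eqP => // E0; rewrite E0 vX in hX.
Qed.

Let p := d - k.
Let H : finType := (E * bool)%type.
Let core : finType := (V * 'I_p)%type.
Let T : finType := (H + core)%type.

Let twin (h : H) : H := (h.1, ~~ h.2).

Let twinK : involutive twin.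
Proof. by case=> e b; rewrite /twin /= negbK. Qed.

Let twin_sym h h' : (h' == twin h) = (h == twin h').
Proof. by rewrite -[h' in LHS]twinK (inj_eq (inv_inj twinK)) eq_sym. Qed.

(* Tutte's gadget: every half-edge is joined to its twin, and every vertex gets
   [d - k] core vertices joined to all its half-edges.  A perfect matching uses
   up [d - k] half-edges at each vertex, and the other [k] are matched to their
   twins.  The weights are [d] times a fractional perfect matching. *)
Definition gadget_weight (u v : T) : nat :=
  match u, v with
  | inl h, inl h' => k * (h' == twin h)
  | inl h, inr c => ep h == c.1
  | inr c, inl h => ep h == c.1
  | inr _, inr _ => 0
  end.

Lemma gadget_weight_sym u v : gadget_weight u v = gadget_weight v u.
Proof. by case: u v => [h|c] [h'|c'] //=; rewrite twin_sym. Qed.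

Lemma sum_cores (P : pred core) v :
  \sum_c (if P c then nat_of_bool (v == c.1) else 0) = \sum_i P (v, i).
Proof.
pose F w i := if P (w, i) then nat_of_bool (v == w) else 0.
rewrite (eq_bigr (fun c => F c.1 c.2)) => [|[w i] _ //].
rewrite -(pair_bigA _ F) /= /F.
rewrite (bigD1 v) //= [X in _ + X]big1 ?addn0 => [|w wv].
  by apply: eq_bigr => i _; rewrite eqxx; case: (P _).
by rewrite big1 // => i _; rewrite eq_sym (negbTE wv); case: (P _).
Qed.

(** A half-edge carries k + p = d; a core vertex meets the d half-edges at its vertex. *)
Lemma gadget_weight_col v : \sum_u gadget_weight u v <= d.
Proof.
rewrite big_sumType /=; case: v => [h|c] /=.
  rewrite -big_distrr /= (eq_bigr (fun h' => nat_of_bool (h' == twin h))) => [|h' _].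
    2: by rewrite twin_sym.
  rewrite sum_eq_indicator muln1 (sum_cores xpredT).
  by rewrite sum_nat_const card_ord muln1 /p; lia.
by rewrite deg big1 // addn0.
Qed.

(** * Odd cuts of Tutte's gadget *)

Section Cut.
Variable C : {set T}.

Let alpha (h : H) := inl h \in C.
Let gamma (v : V) := \sum_i (inr (v, i) \in C).

Let gamma_le v : gamma v <= p.
Proof.
rewrite -[leqRHS]card_ord -sum1_card; apply: leq_sum => i _.
by case: (_ \in _).
Qed.

(** Each cut pair is charged to a half-edge: a twin pair to its half in [C], a core pair to its only
    half-edge. *)
Lemma gadget_cutE :
  \sum_(u in C) \sum_(v | v \notin C) gadget_weight u v =
  \sum_h (k * (alpha h && ~~ alpha (twin h)) +
          (if alpha h then p - gamma (ep h) else gamma (ep h))).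
Proof.
rewrite big_mkcond big_sumType /=.
have -> : \sum_(c : core) (if inr c \in C then
    \sum_(v | v \notin C) gadget_weight (inr c) v else 0) =
    \sum_h (if alpha h then 0 else gamma (ep h)).
  rewrite (eq_bigr (fun c => \sum_h (if alpha h then 0 else
      if inr c \in C then nat_of_bool (ep h == c.1) else 0))) => [|c _].
    rewrite exchange_big /=; apply: eq_bigr => h _.
    case: (alpha h); first by rewrite big1.
    by rewrite (sum_cores (fun c => inr c \in C)).
  case: (inr c \in C); last by rewrite big1 // => h _; case: alpha.
  rewrite big_mkcond big_sumType /= [X in _ + X]big1 ?addn0 => [|c' _]; last by case: ifP.
  by apply: eq_bigr => h _; rewrite /alpha; case: (_ \in C).
rewrite -big_split /=; apply: eq_bigr => h _; rewrite -/(alpha h).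
case: (alpha h) => /=; last by rewrite muln0.
rewrite addn0 big_mkcond big_sumType /=; congr (_ + _).
  rewrite (bigD1 (twin h)) //= eqxx big1 => [|h' /negbTE->]; last by rewrite muln0; case: ifP.
  by rewrite addn0 -/(alpha _); case: alpha; rewrite ?muln0.
rewrite (sum_cores (fun c => inr c \notin C)).
rewrite -[LHS](addKn (gamma (ep h))); congr (_ - _).
rewrite -big_split /= (eq_bigr (fun _ => 1)) => [|i _]; last by case: (_ \in C).
by rewrite sum1_card card_ord.
Qed.

Lemma gadget_card : #|C| = \sum_h alpha h + \sum_v gamma v.
Proof.
rewrite -sum1_card big_mkcond big_sumType /=; congr (_ + _).
by rewrite /gamma pair_bigA; apply: eq_bigr => -[v i] _ /=; case: ifP.
Qed.

Lemma gadget_cut : odd #|C| ->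
  d <= \sum_(u in C) \sum_(v | v \notin C) gadget_weight u v.
Proof.
rewrite gadget_cutE gadget_card => oddC.
(* If [C] splits the cores of [v], each of the d half-edges at [v] is joined to a core on the other
   side. *)
have [/existsP[v /andP[v0 vp]]|nomid] := boolP [exists v, (0 < gamma v) && (gamma v < p)].
  rewrite -(deg v); apply: leq_sum => h _; case: eqP => //= ->.
  by case: (alpha h); lia.
pose X := [set v | gamma v == p].
have gammaE v : gamma v = p * (v \in X).
  move: nomid; rewrite negb_exists => /forallP/(_ v); rewrite negb_and inE.
  by have := gamma_le v; case: eqP => [->|]; rewrite ?muln1 ?muln0 //; lia.
have gX : \sum_v gamma v = #|X| * p.
  rewrite mulnC -sum1_card big_distrr /= [RHS]big_mkcond.
  by apply: eq_bigr => v _; rewrite gammaE; case: (v \in X); rewrite ?muln1 ?muln0.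
pose s e := alpha (e, true) (+) alpha (e, false).
(* Modulo 2, the size of [C] is the number of cut twin pairs plus [#|X| * d], as p and d have equal
   parity; the latter is the parity of the cut of [X]. *)
have oddN : odd (\sum_e s e) (+) odd (\sum_e crossing X e).
  rewrite -(odd_sum_half_edges alpha) -(odd_sum_half_edges (fun h => ep h \in X)).
  move: oddC; rewrite oddD gX sum_end_in !oddM /p oddB //.
  by rewrite (negbTE k_even) addbF.
pose D e :=
  (alpha (e, true) (+) (ep (e, true) \in X)) + (alpha (e, false) (+) (ep (e, false) \in X)).
have -> : \sum_h (k * (alpha h && ~~ alpha (twin h)) +
     (if alpha h then p - gamma (ep h) else gamma (ep h))) =
   \sum_e (k * s e + p * D e).
  rewrite big_half_edges; apply: eq_bigr => e _; rewrite /s /D /twin /= !gammaE.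
  case: (alpha _); case: (alpha _); case: (_ \in X); case: (_ \in X);
    rewrite /= ?muln1 ?muln0; lia.
have DE e : (s e (+) crossing X e) <= D e.
  by rewrite /s /crossing /D; do 2!case: (alpha _); do 2!case: (ep _ \in _).
(* Such an edge alone pays k for its twin pair and at least p for a core side, d in total. *)
have [/existsP[e /andP[se ce]]|le_s] := boolP [exists e, s e && ~~ crossing X e].
  rewrite (bigD1 e) //= (leq_trans _ (leq_addr _ _)) // se.
  have := DE e; rewrite se (negbTE ce) /= => D1.
  by rewrite muln1 -[leqLHS](subnKC le_kd) leq_add2l leq_pmulr.
have {}le_s e : s e -> crossing X e.
  by move=> se; apply: contraNT le_s => ce; apply/existsP; exists e; rewrite se.
pose N := \sum_e (s e (+) crossing X e).
have NE : N + \sum_e s e = \sum_e crossing X e.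
  rewrite -big_split; apply: eq_bigr => e _ /=.
  by have := le_s e; case: (s e); case: crossing => //= /(_ isT).
apply: (@leq_trans (k * (\sum_e s e) + p * N)); last first.
  rewrite !big_distrr -big_split /=; apply: leq_sum => e _.
  by rewrite leq_add2l leq_mul.
have oddNN : odd N by move: oddN; rewrite -NE oddD; case: odd; case: odd.
have N1 : 0 < N by case: (N) oddNN.
(* With no cut twin pair the cut of [X] is odd and [odd_cut] applies; otherwise one twin pair and
   one other crossing edge pay k + p = d. *)
case: (posnP (\sum_e s e)) NE => [->|s1 NE].
  by rewrite muln0 addn0 add0n => NE; rewrite NE mulnC odd_cut // -NE.
by rewrite -[leqLHS](subnKC le_kd) leq_add // leq_pmulr.
Qed.

End Cut.

Lemma regular_factor_of_odd_cuts :
  exists B : {set E}, forall v, \sum_(h | h.1 \in B) (ep h == v) = k.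
Proof.
pose adj : rel T := fun u v => gadget_weight u v != 0.
have adjS : symmetric adj by move=> u v; rewrite /adj gadget_weight_sym.
have adjI : irreflexive adj.
  case=> [[e b]|c]; rewrite /adj //= /twin xpair_eqE eqxx /=.
  by case: b; rewrite muln0.
have [//|m [mK madj]] :=
  matching_of_odd_cuts d_gt0 gadget_weight_col gadget_cut adjS adjI.
pose isl (u : T) := if u is inl _ then true else false.
have m_twin h h' : m (inl h) = inl h' -> h' = twin h.
  move=> E0; have := madj (inl h); rewrite E0 /adj /= muln_eq0 negb_or => /andP[_].
  by rewrite eqb0 negbK => /eqP.
have islP h : isl (m (inl h)) -> m (inl h) = inl (twin h).
  by case E0 : (m _) => [h'|//] _; rewrite (m_twin _ _ E0).
(* The edges whose two half-edges are matched to each other. *)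
pose B := [set e | isl (m (inl (e, true)))].
have BE h : (h.1 \in B) = isl (m (inl h)).
  case: h => e [] /=; rewrite inE //.
  by apply/idP/idP => /islP/(congr1 m); rewrite mK /twin /= => <-.
exists B => v.
(* The matching sends the p cores of [v] bijectively onto these half-edges. *)
have inrE : #|[set h : H | (ep h == v) && ~~ isl (m (inl h))]| = p.
  rewrite -(card_imset _ (@inl_inj H core)).
  rewrite -[RHS]card_ord -cardsT.
  have cI : injective (fun i : 'I_p => inr (v, i) : T) by move=> i j [].
  rewrite -(card_imset _ cI) -[RHS](card_imset _ (inv_inj mK)).
  congr #|pred_of_set _|; apply/setP => u; apply/imsetP/imsetP.
    case=> h; rewrite inE => /andP[/eqP hv nl] ->.
    case E0 : (m (inl h)) nl => [//|[w i]] _.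
    exists (inr (v, i)); first by rewrite imset_f ?inE.
    have := madj (inl h); rewrite E0 /adj /= eqb0 negbK hv => /eqP->.
    by rewrite -E0 mK.
  case=> _ /imsetP[i _ ->] ->; have := madj (inr (v, i)).
  case E0 : (m (inr (v, i))) => [h|c]; rewrite /adj //= eqb0 negbK => hv.
  by exists h; rewrite // inE hv -E0 mK.
have := deg v; rewrite (bigID (fun h => h.1 \in B)) /=.
suff -> : \sum_(h | h.1 \notin B) (ep h == v) = p by move: le_kd; rewrite /p; lia.
rewrite -[RHS]inrE -sum1_card big_mkcond [RHS]big_mkcond; apply: eq_bigr => h _.
by rewrite inE BE; case: (isl _); case: eqP.
Qed.

End Factor.

(** * Even-regular subgraphs, bridges and the flow *)

Lemma big_half_edges_in (E : finType) (B : {set E}) (F : E * bool -> nat) :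
  \sum_(h | h.1 \in B) F h = \sum_(e in B) (F (e, true) + F (e, false)).
Proof.
rewrite big_mkcond big_half_edges [RHS]big_mkcond.
by apply: eq_bigr => e _ /=; case: ifP.
Qed.

(** The cut of [X] has the parity of [#|X| * d], so no cut is odd and the cut condition is
    vacuous. *)
Lemma even_regular_factor (V E : finType) (ep : E * bool -> V) (B : {set E}) (d k : nat) :
    (forall v, \sum_(h | h.1 \in B) (ep h == v) = d) ->
    0 < d -> ~~ odd d -> ~~ odd k -> k <= d ->
  exists B' : {set E}, B' \subset B /\ forall v, \sum_(h | h.1 \in B') (ep h == v) = k.
Proof.
move=> deg d_gt0 d_even k_even le_kd.
pose ep' (h : 'I_#|B| * bool) := ep (enum_val h.1, h.2).
have deg' v : \sum_h (ep' h == v) = d.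
  rewrite -(deg v) big_half_edges_in big_half_edges.
  by rewrite (big_enum_val (fun e => (ep (e, true) == v) + (ep (e, false) == v))).
have [X|B'' B''E] := regular_factor_of_odd_cuts deg' d_gt0 k_even le_kd.
  rewrite -(odd_sum_half_edges (fun h => ep' h \in X)) (sum_end_in deg').
  by rewrite oddM (negbTE d_even) andbF.
exists (enum_val @: B''); split.
  by apply/subsetP => _ /imsetP[i _ ->]; exact: enum_valP.
move=> v; rewrite -(B''E v) !big_half_edges_in big_imset //=.
by move=> i j _ _; exact: enum_val_inj.
Qed.

(** A single crossing edge would be a bridge: deleting it separates its ends, against
    2-edge-connectivity. *)
Lemma crossing_neq1 (G : graph) (ep : edge G * bool -> vertex G) (X : {set vertex G}) :
    edge_connected 2 G -> (forall e, ends e = [set ep (e, true); ep (e, false)]) ->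
  \sum_e crossing ep X e != 1.
Proof.
move=> [_ conn] epE; apply/eqP => cut1.
pose F := [set e | crossing ep X e].
have cardF : #|F| = 1.
  by rewrite -sum1_card big_mkcond -[RHS]cut1; apply: eq_bigr => e _; rewrite inE; case: crossing.
have closedX : closed (adjacent_minus F) X.
  move=> x y /existsP[e /andP[eF /eqP exy]].
  move: eF; rewrite inE /crossing => /negbTE cr.
  have [] : x \in ends e /\ y \in ends e by rewrite exy !inE !eqxx orbT.
  by rewrite epE !in_set2 => /orP[]/eqP-> /orP[]/eqP->; move: cr; do 2!case: (ep _ \in X).
have [e eF] : exists e, e \in F by apply/set0Pn; rewrite -card_gt0 cardF.
move: eF; rewrite inE /crossing.
have := closed_connect closedX (conn F _ (ep (e, true)) (ep (e, false))).
by rewrite cardF => /(_ isT)->; rewrite addbb.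
Qed.

Lemma even_between_half_and_two_thirds (r : nat) : 3 <= r -> odd r -> r <> 5 ->
  exists k, [/\ ~~ odd k, r <= 2 * k & 3 * k <= 2 * r].
Proof.
move=> r3 rodd r5.
(* With r = 2q+1 this is the first even number above r/2. For even q the bound 3(q+2) <= 2r means q
   >= 4, which fails for r = 5. *)
exists (if odd r./2 then r./2.+1 else r./2.+2).
by case: (boolP (odd r./2)) => o2; split; lia.
Qed.

Import GRing.Theory.

Theorem theorem10 (r : nat) (hr3 : (3 <= r)%N) (hodd : odd r) (hr5 : r <> 5%N)
    (G : graph) (hconn : edge_connected 2 G) (hreg : regular G r) :
  admits_sum_flow 0%R 3 G.
Proof.
have [k [k_even rk kr]] := even_between_half_and_two_thirds hr3 hodd hr5.
have ends_pair e : exists p : vertex G * vertex G, p.1 != p.2 /\ ends e = [set p.1; p.2].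
  by have /eqP/cards2P[x [y [xy eE]]] := card_ends e; exists (x, y).
have [f fE] := fin_all_exists ends_pair.
pose ep (h : edge G * bool) := if h.2 then (f h.1).1 else (f h.1).2.
have epE e : ends e = [set ep (e, true); ep (e, false)] by case: (fE e).
have endE e v : ((ep (e, true) == v) + (ep (e, false) == v))%N = (v \in ends e).
  rewrite epE in_set2 ![v == _]eq_sym /ep /=; have [ne _] := fE e.
  by case: eqP => [<-|//]; rewrite eq_sym (negbTE ne).
have degE v (B : {set edge G}) :
    (\sum_(h | h.1 \in B) (ep h == v) = \sum_(e in incident_edges v) (e \in B))%N.
  rewrite big_half_edges_in big_mkcond [RHS]big_mkcond.
  by apply: eq_bigr => e _; rewrite endE inE; case: (e \in B); case: (v \in _).
have deg v : (\sum_h (ep h == v) = r)%N.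
  have := degE v setT; rewrite (eq_bigl xpredT) => [->|h]; last by rewrite inE.
  by rewrite -(hreg v) -sum1_card; apply: eq_bigr => e _; rewrite inE.
have r_gt0 : (0 < r)%N by lia.
(* Odd cuts have size at least 3, and 3(r-k) >= r is the bound 3k <= 2r. *)
have [|X oddX|B degB] := regular_factor_of_odd_cuts deg r_gt0 k_even; first by lia.
  have := crossing_neq1 X hconn epE => cut1.
  have cut3 : (3 <= \sum_e crossing ep X e)%N.
    by move: oddX cut1; case: (\sum_e _)%N => [|[|[|n]]].
  by apply: leq_trans (leq_mul cut3 (leqnn _)); lia.
(* The degree 2r-3k is even, and it is at most k because r <= 2k. *)
have [||||B' [sB'B degB']] := even_regular_factor (k := (2 * r - 3 * k)%N) degB; try lia.
exists (fun e => if e \in B then if e \in B' then (-2)%R else (-1)%R else 2%R).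
split=> [e|v]; first by case: (e \in B) => //; case: (e \in B').
(* Since [B'] lies in [B], the weight is linear in the two indicators, and the vertex sum is 2r - 3k
   - (2r-3k) = 0. *)
rewrite (eq_bigr (fun e => Posz 2 - Posz (3 * (e \in B)) - Posz (e \in B'))%R) => [|e _].
  rewrite !sumrB -!(big_morph Posz PoszD (erefl _)) -big_distrr /= -!degE degB degB'.
  rewrite sum_nat_const; have := hreg v; rewrite /incident_edges => ->; lia.
case: (boolP (e \in B)) => eB; first by case: (e \in B').
by rewrite (negbTE (contra (subsetP sB'B e) eB)).
Qed.
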